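(* There is an absolute constant $c>0$ such that, for all sufficiently large $n$ and every $1\le k\le n$, the half-lazy $k$-column transvection walk $Q_{n,k}$ on $\mathrm{St}(n,k)$ satisfies \[ \tau_{\mathrm{mix}}(Q_{n,k})\ge c\max\left(n\log n,\ \frac{nk}{\log(en)}\right). \]
   Context: Let $V=\mathbb F_2^k$ and $\mathrm{St}(n,k)=\{(z_1,\dots,z_n)\in V^n:\operatorname{span}(z_1,\dots,z_n)=V\}$. The $k$-column transvection kernel $P_{n,k}$ on $\mathrm{St}(n,k)$ is: choose an ordered pair $(a,b)$ of distinct indices in $\{1,\dots,n\}$ uniformly at random and replace $z_b$ by $z_b+z_a$, leaving other rows unchanged. The half-lazy kernel is $Q_{n,k}=\tfrac12(I+P_{n,k})$, with uniform stationary distribution $\pi$ on $\mathrm{St}(n,k)$. The mixing time is $\tau_{\mathrm{mix}}(Q)=\min\{t\ge0:\max_x\|Q^t(x,\cdot)-\pi\|_{\mathrm{TV}}\le1/4\}$. *)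

(* Defs.v *)
From Stdlib Require Import Reals ClassicalDescription.
From HB Require Import structures.
From mathcomp Require Import all_boot all_order all_algebra.
From mathcomp Require Import Rstruct.
Set Implicit Arguments. Unset Strict Implicit. Unset Printing Implicit Defensive.
Import Order.TTheory GRing.Theory Num.Theory.
Local Open Scope ring_scope.

(* A configuration (z_1,...,z_n) in V^n, V = F_2^k, is an n x k matrix over
   F_2 whose i-th row is z_i. *)
Definition config (n k : nat) := 'M['F_2]_(n, k).

Definition St (n k : nat) : {set config n k} := [set M | row_full M].

Definition transv (n k : nat) (M : config n k) (a b : 'I_n) : config n k :=
  \matrix_(i, j) (if i == b then M b j + M a j else M i j).

Definition Pker (n k : nat) (x y : config n k) : R :=
  (#|[set ab : 'I_n * 'I_n | (ab.1 != ab.2) && (transv x ab.1 ab.2 == y)]|%:R)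
  / ((n * n.-1)%N%:R).

Definition Qker (n k : nat) (x y : config n k) : R :=
  ((x == y)%:R + Pker x y) / 2.

Fixpoint Qpow (n k : nat) (t : nat) (x y : config n k) : R :=
  match t with
  | 0 => (x == y)%:R
  | t'.+1 => \sum_(z in St n k) Qpow t' x z * Qker z y
  end.

Definition unif (n k : nat) (y : config n k) : R := (#|St n k|%:R)^-1.

Definition tv_dist (n k : nat) (t : nat) (x : config n k) : R :=
  (\sum_(y in St n k) `|Qpow t x y - unif y|) / 2.

Definition mixed (n k : nat) (t : nat) : bool :=
  [forall x in St n k, tv_dist t x <= 4^-1].

(* tau_mix(Q) = min { t >= 0 : mixed t } (0 if the set were empty,
   which does not happen: the lazy chain is irreducible on St(n,k)). *)
Definition tau_mix (n k : nat) : nat :=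
  match excluded_middle_informative (exists t, mixed n k t) with
  | left h => ex_minn h
  | right _ => 0%N
  end.

(* Main.v *)
Require Import Defs.
From Stdlib Require Import Reals ClassicalDescription.
From HB Require Import structures.
From mathcomp Require Import all_boot all_order all_algebra.
From mathcomp Require Import Rstruct.
From mathcomp Require Import zify lra ring.
Set Implicit Arguments. Unset Strict Implicit. Unset Printing Implicit Defensive.
Import Order.TTheory GRing.Theory Num.Theory.
Local Open Scope ring_scope.

(* n log n: the number of nonzero entries in the first column grows in mean by
   a factor at most 1 + 1/(2n) per step. Started from the unit columns it is
   1, under pi its mean is at least n/2, and total variation distance 1/4
   changes the mean of a [0, n]-valued function by at most n/4; hence
   (1 + 1/(2n))^t >= n/4 at a mixed time t.
   nk / log n: each state has at most n^2 successors, so the support of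
   Q^t(x, .) has at most n^(2t) points, and it must contain half of St(n,k),
   which has at least 2^(k(n-1)/2) elements.
   As tau_mix is 0 when no time is mixed, convergence is needed as well: by
   Gaussian elimination and laziness some power of Q is entrywise positive
   on St(n,k), and Doeblin's argument applies. *)

(** * Arithmetic of F_2 and transvections as row operations *)

Lemma F2_neq0 (x : 'F_2) : x != 0 -> x = 1.
Proof. by case: x => [[|[|m]] Hm] // _; apply/val_inj. Qed.

Lemma F2_addrr (x : 'F_2) : x + x = 0.
Proof. by case: x => [[|[|m]] Hm] //; apply/val_inj. Qed.

Lemma transvE (n k : nat) (M : config n k) (a b : 'I_n) :
  transv M a b = (1%:M + delta_mx b a) *m M.
Proof.
apply/matrixP => i j; rewrite mulmxDl mul1mx !mxE.
case: eqP => [->|ib].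
  rewrite (bigD1 a) //= !mxE !eqxx mul1r big1 ?addr0 // => l la.
  by rewrite !mxE (negbTE la) andbF mul0r.
rewrite big1 ?addr0 // => l _; rewrite !mxE.
by case: eqP => // _; rewrite mul0r.
Qed.

Lemma transvK (n k : nat) (M : config n k) (a b : 'I_n) :
  a != b -> transv (transv M a b) a b = M.
Proof.
move=> ab; apply/matrixP => i j; rewrite !mxE eqxx (negbTE ab).
by case: eqP => [->|//]; rewrite -addrA F2_addrr addr0.
Qed.

(** A transvection is a left multiplication, which cannot raise the rank; being an involution, it
    cannot lower it either. *)
Lemma transv_St (n k : nat) (M : config n k) (a b : 'I_n) :
  a != b -> (transv M a b \in St n k) = (M \in St n k).
Proof.
move=> ab; rewrite !inE /row_full; apply/eqP/eqP => h.
  apply/eqP; rewrite eqn_leq rank_leq_col -{1}h transvE.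
  exact: mxrankM_maxr.
apply/eqP; rewrite eqn_leq rank_leq_col -{1}h.
by rewrite -{1}(transvK M ab) transvE mxrankM_maxr.
Qed.

(** The hypothesis is applied to [cokermx M], which [M] annihilates and which vanishes only at full
    column rank. *)
Lemma row_full_ker (n k : nat) (M : config n k) :
  (forall B : 'M['F_2]_k, M *m B = 0 -> B = 0) -> row_full M.
Proof. by move=> h; rewrite -cokermx_eq0; apply/eqP/h/mulmx_coker. Qed.

Lemma pairs_card (n : nat) :
  #|[pred ab : 'I_n * 'I_n | ab.1 != ab.2]| = (n * n.-1)%N.
Proof.
rewrite -sum1_card.
rewrite -(pair_big_dep xpredT (fun a b : 'I_n => a != b) (fun _ _ => 1%N)) /=.
rewrite (eq_bigr (fun=> n.-1)) ?sum_nat_const ?card_ord // => a _.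
rewrite sum1_card -[in RHS](card_ord n) -(cardC1 a).
by apply: eq_card => b; rewrite !inE eq_sym.
Qed.

(* In Defs the body of an R-valued definition is parsed in R_scope, so its
   outermost operations are Stdlib's; PkerE, QkerE and tv_distE restate them in
   terms of the ring structure. *)
Lemma IZR2E : IZR 2 = 2 :> R.
Proof. by rewrite IZRposE INRE. Qed.

Lemma PkerE (n k : nat) (x y : config n k) :
  Pker x y = #|[set ab : 'I_n * 'I_n | (ab.1 != ab.2) &&
                 (transv x ab.1 ab.2 == y)]|%:R / (n * n.-1)%N%:R.
Proof. by rewrite /Pker RdivE. Qed.

Lemma QkerE (n k : nat) (x y : config n k) :
  Qker x y = ((x == y)%:R + Pker x y) / 2.
Proof. by rewrite /Qker RdivE RplusE IZR2E. Qed.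

Lemma tv_distE (n k t : nat) (x : config n k) :
  tv_dist t x = (\sum_(y in St n k) `|Qpow t x y - unif y|) / 2.
Proof. by rewrite /tv_dist RdivE IZR2E. Qed.

(** * One-step expectations and double stochasticity *)

(** Exchanging sums replaces targets by moves: moves preserve St(n,k), so each pair contributes to
    exactly one [y] of the sum. *)
Lemma Pker_expect (n k : nat) (g : config n k -> R) (x : config n k) :
  x \in St n k ->
  \sum_(y in St n k) Pker x y * g y =
  (\sum_(ab : 'I_n * 'I_n | ab.1 != ab.2) g (transv x ab.1 ab.2))
    / (n * n.-1)%N%:R.
Proof.
move=> xS; rewrite big_distrl /=.
have E y : Pker x y * g y = \sum_(ab : 'I_n * 'I_n | ab.1 != ab.2)
     (if y == transv x ab.1 ab.2 then g y / (n * n.-1)%N%:R else 0).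
  rewrite PkerE -sum1_card natr_sum mulrAC -mulrA big_distrl /=.
  rewrite -big_mkcondr /=; apply: eq_big => [ab|ab _]; rewrite ?mul1r //.
  by rewrite !inE (eq_sym y).
under eq_bigr do rewrite E.
rewrite exchange_big /=; apply: eq_bigr => ab ne.
by rewrite -big_mkcondr /= (big_pred1 (transv x ab.1 ab.2)) // => y;
  rewrite andb_idl // => /eqP ->; rewrite transv_St.
Qed.

Lemma delta_expect (n k : nat) (g : config n k -> R) (x : config n k) :
  x \in St n k -> \sum_(y in St n k) (x == y)%:R * g y = g x.
Proof.
move=> xS; rewrite (bigD1 x) //= eqxx mul1r big1 ?addr0 // => y /andP[_ yx].
by rewrite eq_sym (negbTE yx) mul0r.
Qed.

Lemma Qker_expect (n k : nat) (g : config n k -> R) (x : config n k) :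
  x \in St n k ->
  \sum_(y in St n k) Qker x y * g y =
  (g x + (\sum_(ab : 'I_n * 'I_n | ab.1 != ab.2) g (transv x ab.1 ab.2))
    / (n * n.-1)%N%:R) / 2.
Proof.
move=> xS; rewrite -Pker_expect // -[in RHS](delta_expect g xS).
rewrite -big_split /= mulr_suml; apply: eq_bigr => y _.
rewrite QkerE; ring.
Qed.

Lemma Pker_ge0 (n k : nat) (x y : config n k) : 0 <= Pker x y.
Proof. by rewrite PkerE divr_ge0 ?ler0n. Qed.

Lemma Qker_ge0 (n k : nat) (x y : config n k) : 0 <= Qker x y.
Proof. by rewrite QkerE divr_ge0 ?addr_ge0 ?Pker_ge0 ?ler0n. Qed.

Lemma Qpow_ge0 (n k t : nat) (x y : config n k) : 0 <= Qpow t x y.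
Proof.
elim: t y => [|t IH] y /=; first exact: ler0n.
by apply: sumr_ge0 => z _; rewrite mulr_ge0 ?Qker_ge0.
Qed.

(** Each transvection is its own inverse, so the pairs leading from [x] to [y] are those leading
    from [y] to [x]. *)
Lemma Qker_sym (n k : nat) (x y : config n k) : Qker x y = Qker y x.
Proof.
rewrite !QkerE !PkerE eq_sym; congr ((_ + _%:R / _) / _).
apply: eq_card => ab; rewrite !inE.
by case: eqP => //= /eqP ne; apply/eqP/eqP => <-; rewrite transvK.
Qed.

Lemma pairs_neq0 (n : nat) : (1 < n)%N -> (n * n.-1)%N%:R != 0 :> R.
Proof. by case: n => [|[|n]] // _; rewrite pnatr_eq0. Qed.

Lemma Qker_sum1 (n k : nat) (x : config n k) : (1 < n)%N -> x \in St n k ->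
  \sum_(y in St n k) Qker x y = 1.
Proof.
move=> n1 xS; have := Qker_expect (fun=> 1) xS.
under eq_bigr do rewrite mulr1.
move->; rewrite -[X in _ + X / _](_ : (n * n.-1)%N%:R = _); last first.
  by rewrite sumr_const pairs_card.
by rewrite divff ?pairs_neq0 //; lra.
Qed.

Lemma Qpow_expectS (n k t : nat) (g : config n k -> R) (x : config n k) :
  \sum_(y in St n k) Qpow t.+1 x y * g y =
  \sum_(z in St n k) Qpow t x z * \sum_(y in St n k) Qker z y * g y.
Proof.
under eq_bigr do rewrite /= big_distrl /=.
rewrite exchange_big /=; apply: eq_bigr => z _; rewrite big_distrr /=.
by apply: eq_bigr => y _; rewrite mulrA.
Qed.

Lemma Qpow_sum1 (n k t : nat) (x : config n k) : (1 < n)%N -> x \in St n k ->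
  \sum_(y in St n k) Qpow t x y = 1.
Proof.
move=> n1 xS; elim: t => [|t IH].
  by have := delta_expect (fun=> 1) xS; under eq_bigr do rewrite mulr1.
have := Qpow_expectS t (fun=> 1) x; under eq_bigr do rewrite mulr1.
move->; rewrite -[RHS]IH; apply: eq_bigr => z zS.
by under eq_bigr do rewrite mulr1; rewrite Qker_sum1 ?mulr1.
Qed.

(** Symmetry turns row sums into column sums; this is the stationarity of the uniform law. *)
Lemma Qpow_colsum1 (n k t : nat) (y : config n k) : (1 < n)%N ->
  y \in St n k -> \sum_(x in St n k) Qpow t x y = 1.
Proof.
move=> n1; elim: t y => [|t IH] y yS /=.
  rewrite -[RHS](delta_expect (fun=> 1) yS); apply: eq_bigr => x _.
  by rewrite mulr1 eq_sym.
rewrite exchange_big /= -[RHS](Qker_sum1 n1 yS).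
apply: eq_bigr => z zS.
by rewrite -big_distrl /= IH // mul1r Qker_sym.
Qed.

Lemma Qpow_add (n k s t : nat) (x y : config n k) : y \in St n k ->
  Qpow (s + t) x y = \sum_(z in St n k) Qpow s x z * Qpow t z y.
Proof.
elim: t y => [|t IH] y yS.
  rewrite addn0 -[LHS](delta_expect (Qpow s x) yS).
  by apply: eq_bigr => z _ /=; rewrite mulrC eq_sym.
rewrite addnS /=.
under eq_bigr => w wS do rewrite IH // big_distrl /=.
rewrite exchange_big /=; apply: eq_bigr => z _; rewrite big_distrr /=.
by apply: eq_bigr => w _; rewrite mulrA.
Qed.

(** * Irreducibility by Gaussian elimination *)

Definition step (n k : nat) : rel (config n k) :=
  [rel x y | [exists ab : 'I_n * 'I_n, (ab.1 != ab.2) && (transv x ab.1 ab.2 == y)]].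

Lemma step_transv (n k : nat) (x : config n k) (a b : 'I_n) :
  a != b -> step x (transv x a b).
Proof. by move=> ab; apply/existsP; exists (a, b); rewrite ab /=. Qed.

Lemma step_sym (n k : nat) : symmetric (@step n k).
Proof.
have H x y : @step n k x y -> step y x.
  move=> /existsP[[a b] /= /andP[ab /eqP <-]].
  by apply/existsP; exists (a, b); rewrite ab /= transvK.
by move=> x y; apply/idP/idP; apply: H.
Qed.

Lemma connect_St (n k : nat) (x y : config n k) :
  connect (@step n k) x y -> x \in St n k -> y \in St n k.
Proof.
move=> /connectP[p]; elim: p x => [|z p IH] x /=; first by move=> _ ->.
move=> /andP[/existsP[[a b] /= /andP[ab /eqP <-]] pp] e xS.
by apply: (IH _ pp e); rewrite transv_St.
Qed.

(** The rows in [s] are treated one at a time; row [j] lies outside [s], so it keeps its value along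
    the path. *)
Lemma connect_add_row (n k : nat) (x : config n k) (j : 'I_n) (s : seq 'I_n) :
  uniq s -> j \notin s ->
  connect (@step n k) x (\matrix_(i, c) (x i c + (if i \in s then x j c else 0))).
Proof.
elim: s => [|i s IH] /=.
  move=> _ _; rewrite (_ : \matrix_(_, _) _ = x) ?connect0 //.
  by apply/matrixP => i c; rewrite !mxE addr0.
move=> /andP[nis us]; rewrite inE negb_or => /andP[ji js].
apply: connect_trans (IH us js) _; apply: connect1.
set y := (X in step X _).
rewrite (_ : \matrix_(_, _) _ = transv y j i); first exact: step_transv.
apply/matrixP => l c; rewrite !mxE inE (negbTE js) addr0.
by case: eqP => [->|//]; rewrite (negbTE nis) addr0.
Qed.

Lemma pivot_exists (n k : nat) (x : config n k) (j : 'I_k) : (k <= n)%N ->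
  x \in St n k -> (forall i (c : 'I_k), (c < j)%N -> x i c = (i == c :> nat)%:R) ->
  exists2 i : 'I_n, (j <= i)%N & x i j = 1.
Proof.
move=> kn; rewrite inE => /row_full_inj inj xE.
case: (pickP [pred i : 'I_n | (j <= i)%N && (x i j != 0)]) => [i /= /andP[ji /F2_neq0]|no].
  by exists i.
(* otherwise column j is a combination of the unit columns before it *)
pose v : 'cV['F_2]_k := \col_c (if (c < j)%N then x (widen_ord kn c) j else (c == j)%:R).
have v0 : v = 0.
  apply: inj; rewrite mulmx0; apply/matrixP => i l; rewrite !mxE.
  rewrite (bigD1 j) //= !mxE ltnn eqxx mulr1.
  (* In a row above [j], the entry [x i j] arises twice, from coordinates [j] and [i] of [v], and
     cancels in characteristic 2. In the other rows every term is zero. *)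
  have [ij|ji] := ltnP i j.
    have ik : (i < k)%N by apply: ltn_trans ij _.
    rewrite (bigD1 (Ordinal ik)) /=; last by rewrite -val_eqE /= neq_ltn ij.
    rewrite !mxE /= ij (xE i (Ordinal ik)) //= eqxx mul1r.
    rewrite (_ : widen_ord kn (Ordinal ik) = i); last exact/val_inj.
    rewrite addrA F2_addrr add0r big1 // => c /andP[cj ci]; rewrite !mxE.
    case: ltnP => // cj'; last by rewrite (negbTE cj) mulr0.
    rewrite xE //; case: eqP => [e|]; last by rewrite mul0r.
    by case/eqP: ci; apply/val_inj.
  have := no i; rewrite /= ji /= => /negbFE/eqP ->; rewrite add0r big1 // => c cj.
  rewrite !mxE; case: ltnP => // cj'; last by rewrite (negbTE cj) mulr0.
  rewrite xE //; case: eqP => [e|]; last by rewrite mul0r.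
  by move: cj'; rewrite -e ltnNge ji.
by have := congr1 (fun v : 'cV_k => v j 0) v0; rewrite !mxE ltnn eqxx.
Qed.

Lemma connect_pivots (n k : nat) (x : config n k) (m : nat) :
  (m <= k <= n)%N -> x \in St n k ->
  exists2 y, connect (@step n k) x y &
    forall i (c : 'I_k), (c < m)%N -> y i c = (i == c :> nat)%:R.
Proof.
move=> /andP[mk kn] xS; elim: m mk => [|m IH] mk; first by exists x.
have [y xy yE] := IH (ltnW mk); pose j := Ordinal mk.
have yS := connect_St xy xS.
have [i ji yij] := pivot_exists (j := j) kn yS yE.
pose j' : 'I_n := widen_ord kn j.
have [z yz [zE zj]] : exists2 z, connect (@step n k) y z &
    (forall i (c : 'I_k), (c < m)%N -> z i c = (i == c :> nat)%:R) /\ z j' j = 1.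
  (* Row [i] vanishes in the columns before [j] because [j <= i], so adding it to the diagonal row
     leaves them intact. *)
  have [yj0|/F2_neq0 yj] := eqVneq (y j' j) 0; last by exists y.
  have ij : i != j'.
    by apply/eqP => e; move: yj0; rewrite -e yij.
  exists (transv y i j'); first exact/connect1/step_transv.
  split=> [l c cm|]; last by rewrite !mxE eqxx yj0 yij add0r.
  rewrite !mxE; case: eqP => [->|_]; last exact: yE.
  by rewrite (yE i) //= (gtn_eqF (leq_trans cm ji)) addr0 yE.
(* The rows to be cleared by adding row [j'], which is also zero in all earlier columns. *)
pose s := [seq l <- enum 'I_n | (l != j') && (z l j != 0)].
have us : uniq s by rewrite filter_uniq ?enum_uniq.
have js : j' \notin s by rewrite mem_filter eqxx.
exists (\matrix_(l, c) (z l c + (if l \in s then z j' c else 0))).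
  exact: connect_trans xy (connect_trans yz (connect_add_row _ us js)).
move=> l c; rewrite ltnS leq_eqVlt !mxE mem_filter mem_enum andbT.
move=> /orP[/eqP cm|cm]; last first.
  by rewrite (zE j') //= (gtn_eqF cm) if_same addr0 zE.
have -> : c = j by apply/val_inj.
have -> : (l == j :> nat) = (l == j') by rewrite -val_eqE.
have [->|lj] /= := eqVneq l j'; first by rewrite addr0 zj.
by case: eqVneq => [->|/F2_neq0 ->]; rewrite ?addr0 // zj F2_addrr.
Qed.

(** Both states reduce to the same normal form, the unit columns, and moves are reversible. *)
Lemma step_connected (n k : nat) (x y : config n k) : (k <= n)%N ->
  x \in St n k -> y \in St n k -> connect (@step n k) x y.
Proof.
move=> kn xS yS.
have kkn : (k <= k <= n)%N by rewrite leqnn.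
have [x' xx' x'E] := connect_pivots kkn xS.
have [y' yy' y'E] := connect_pivots kkn yS.
have e : x' = y' by apply/matrixP => i c; rewrite x'E ?y'E.
rewrite -e in yy'; apply: connect_trans xx' _.
by rewrite (sym_connect_sym (@step_sym n k)).
Qed.

(** * Positivity of a power of the kernel *)

Lemma Qker_refl_gt0 (n k : nat) (x : config n k) : 0 < Qker x x.
Proof. by rewrite QkerE eqxx divr_gt0 ?ltr_wpDr ?Pker_ge0 ?ltr01 ?ltr0n. Qed.

Lemma Qker_step_gt0 (n k : nat) (x y : config n k) :
  (1 < n)%N -> step x y -> 0 < Qker x y.
Proof.
move=> n1 /existsP[ab abP]; rewrite QkerE divr_gt0 ?ltr0n // ltr_wpDl ?ler0n //.
rewrite PkerE divr_gt0 // ltr0n; last by case: n n1 {x y ab abP} => [|[]].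
by apply/card_gt0P; exists ab; rewrite inE.
Qed.

Lemma QpowS_gt0 (n k t : nat) (x y z : config n k) :
  z \in St n k -> 0 < Qpow t x z -> 0 < Qker z y -> 0 < Qpow t.+1 x y.
Proof.
move=> zS xz zy /=; rewrite (bigD1 z) //=; apply: ltr_wpDr; last exact: mulr_gt0.
by apply: sumr_ge0 => w _; rewrite mulr_ge0 ?Qpow_ge0 ?Qker_ge0.
Qed.

Lemma Qpow_lazy_gt0 (n k s t : nat) (x y : config n k) :
  y \in St n k -> 0 < Qpow s x y -> 0 < Qpow (s + t) x y.
Proof.
move=> yS xy; elim: t => [|t IH]; first by rewrite addn0.
by rewrite addnS; apply: QpowS_gt0 yS IH (Qker_refl_gt0 y).
Qed.

Lemma Qpow_path_gt0 (n k t : nat) (w x : config n k) (p : seq (config n k)) :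
  (1 < n)%N -> x \in St n k -> 0 < Qpow t w x -> path (@step n k) x p ->
  0 < Qpow (t + size p) w (last x p).
Proof.
move=> n1; elim: p t x => [|y p IH] t x xS wx /=; first by rewrite addn0.
move=> /andP[xy pp]; rewrite -addSnnS; apply: IH pp.
  exact: connect_St (connect1 xy) xS.
exact: QpowS_gt0 xS wx (Qker_step_gt0 n1 xy).
Qed.

(** The number of configurations bounds the length of every simple path, and laziness pads each path
    to this common length. *)
Lemma Qpow_primitive (n k : nat) : (1 < n)%N -> (k <= n)%N ->
  exists t, {in St n k &, forall x y : config n k, 0 < Qpow t x y}.
Proof.
move=> n1 kn; exists #|{: config n k}| => x y xS yS.
have /connectP[p0 pp0 ->] := step_connected kn xS yS.
case/shortenP: pp0 => p pp /card_uniqP /= up _.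
have le : (size p <= #|{: config n k}|)%N by rewrite ltnW // -up max_card.
have lS : last x p \in St n k.
  by apply: connect_St xS; apply/connectP; exists p.
rewrite -(subnKC le) -[size p]add0n; apply: Qpow_lazy_gt0 => //.
by apply: Qpow_path_gt0 => //=; rewrite eqxx ltr01.
Qed.

(** * Doeblin contraction and existence of a mixed time *)

Lemma sum_unif (n k : nat) (x : config n k) : x \in St n k ->
  \sum_(y in St n k) unif y = 1 :> R.
Proof.
move=> xS; rewrite sumr_const /unif -[LHS]mulr_natr mulVf // pnatr_eq0.
by rewrite -lt0n; apply/card_gt0P; exists x.
Qed.

(** The deviation has total mass 0, so subtracting [d] from every entry of the [t]-step kernel does
    not change its image. What remains is nonnegative with row sums [1 - #|St n k| * d]. *)
Lemma deviation_contract (n k s t : nat) (d : R) (x : config n k) :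
  (1 < n)%N -> x \in St n k ->
  {in St n k &, forall y z : config n k, d <= Qpow t y z} ->
  \sum_(y in St n k) `|Qpow (s + t) x y - unif y| <=
  (1 - #|St n k|%:R * d) * \sum_(y in St n k) `|Qpow s x y - unif y|.
Proof.
move=> n1 xS dQ.
have dev0 : \sum_(z in St n k) (Qpow s x z - unif z) = 0.
  by rewrite sumrB Qpow_sum1 // (sum_unif xS) subrr.
have E y : y \in St n k -> Qpow (s + t) x y - unif y =
    \sum_(z in St n k) (Qpow s x z - unif z) * (Qpow t z y - d).
  move=> yS; under eq_bigr do rewrite mulrBr.
  rewrite sumrB -big_distrl /= dev0 mul0r subr0.
  (* Column sums equal to 1 make the uniform law invariant. *)
  under eq_bigr do rewrite mulrBl.
  rewrite sumrB -Qpow_add //; congr (_ - _).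
  by rewrite -big_distrr /= Qpow_colsum1 // mulr1.
have le1 y : y \in St n k -> `|Qpow (s + t) x y - unif y| <=
    \sum_(z in St n k) `|Qpow s x z - unif z| * (Qpow t z y - d).
  move=> yS; rewrite E //; apply: le_trans (ler_norm_sum _ _ _) _.
  apply: ler_sum => z zS; rewrite normrM ler_wpM2l // ger0_norm //.
  by rewrite subr_ge0 dQ.
apply: le_trans (ler_sum _ le1) _.
rewrite exchange_big mulrC big_distrl /=; apply: ler_sum => z zS.
rewrite -big_distrr /= ler_wpM2l // sumrB Qpow_sum1 // sumr_const.
by rewrite mulr_natl.
Qed.

Lemma exists_mixed (n k : nat) : (1 < n)%N -> (k <= n)%N ->
  exists t, mixed n k t.
Proof.
move=> n1 kn; have [t0 pos] := Qpow_primitive n1 kn.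
have [St0|[x0 x0S]] := set_0Vmem (St n k).
  by exists 0%N; apply/forall_inP => x; rewrite St0 inE.
(* The smallest of finitely many positive entries. *)
have [d d0 dQ] : exists2 d : R, 0 < d &
    {in St n k &, forall y z : config n k, d <= Qpow t0 y z}.
  pose P := [pred xy : config n k * config n k | (xy.1 \in St n k) && (xy.2 \in St n k)].
  pose F (xy : config n k * config n k) : R := Qpow t0 xy.1 xy.2.
  have P0 : P (x0, x0) by rewrite /= x0S.
  have [[x y] /= /andP[xS yS] mn] := arg_minP F P0.
  exists (Qpow t0 x y); first exact: pos.
  by move=> u v uS vS; apply: (mn (u, v)); rewrite /= uS.
pose r := 1 - #|St n k|%:R * d.
have N0 : (0 < #|St n k|)%N by apply/card_gt0P; exists x0.
have r1 : r < 1 by rewrite /r ltrBlDr ltrDl mulr_gt0 ?ltr0n.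
have r0 : 0 <= r.
  rewrite /r subr_ge0 mulr_natl -[leRHS](Qpow_sum1 t0 n1 x0S) -sumr_const.
  by apply: ler_sum => y yS; apply: dQ.
(* The factor 2 is the largest possible L1 distance between two probability laws. *)
have D m x : x \in St n k ->
    \sum_(y in St n k) `|Qpow (m * t0) x y - unif y| <= r ^+ m * 2.
  move=> xS; elim: m => [|m IH].
    rewrite mul0n expr0 mul1r.
    apply: (@le_trans _ _ (\sum_(y in St n k) (Qpow 0 x y + unif y))).
      apply: ler_sum => y _; apply: le_trans (ler_normB _ _) _.
      by rewrite !ger0_norm // ?invr_ge0 ?Qpow_ge0 ?ler0n.
    by rewrite big_split /= (Qpow_sum1 0) // (sum_unif xS); lra.
  rewrite mulSn addnC; apply: le_trans (deviation_contract _ n1 xS dQ) _.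
  by rewrite exprS -mulrA ler_wpM2l.
have /RltP q0 : 0 < 4^-1 :> R by rewrite invr_gt0 ltr0n.
have ar1 : Rlt (Rabs r) 1 by rewrite RabsE ger0_norm //; apply/RltP.
have [m mP] := pow_lt_1_zero r ar1 _ q0.
have rm : r ^+ m <= 4^-1.
  have := mP m (Nat.le_refl m); rewrite RpowE RabsE => /RltP/ltW.
  by rewrite ger0_norm // exprn_ge0.
exists (m * t0)%N; apply/forall_inP => x xS.
have := D m x xS; rewrite tv_distE; move: rm.
set a := \sum_(y in _) _; set b := r ^+ m; lra.
Qed.

(** * Size of the support after t steps *)

(** The diagonal pairs, which are not moves, encode the lazy step, so that [n * n] labels cover all
    transitions. *)
Definition succs (n k : nat) (x : config n k) : {set config n k} :=
  [set if ab.1 == ab.2 then x else transv x ab.1 ab.2 | ab : 'I_n * 'I_n].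

Lemma Qker_succs (n k : nat) (x y : config n k) :
  (0 < n)%N -> Qker x y != 0 -> y \in succs x.
Proof.
move=> n0; apply: contraNT => ny; rewrite QkerE PkerE.
have -> : (x == y) = false.
  apply: contraNF ny => /eqP <-; apply/imsetP.
  by exists (Ordinal n0, Ordinal n0); rewrite //= eqxx.
rewrite (_ : [set _ | _] = set0) ?cards0 ?mul0r ?addr0 ?mul0r //.
apply/setP => ab; rewrite !inE; apply/negbTE.
apply: contraNN ny => /andP[ab12 /eqP <-]; apply/imsetP; exists ab => //.
by rewrite (negbTE ab12).
Qed.

Lemma Qpow_support (n k t : nat) (x : config n k) : (0 < n)%N ->
  (#|[set y | (Qpow t x y != 0)%R]| <= (n * n) ^ t)%N.
Proof.
move=> n0; elim: t => [|t IH].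
  rewrite expn0 -[leqRHS](cards1 x); apply/subset_leq_card/subsetP => y.
  by rewrite !inE /=; case: (eqVneq x y); rewrite //= eqxx.
pose A := [set z | Qpow t x z != 0].
have sub : [set y | Qpow t.+1 x y != 0] \subset \bigcup_(z in A) succs z.
  apply/subsetP => y; rewrite inE /= => h; apply/bigcupP.
  have [z zP|none] := pickP [pred z | (z \in A) && (Qker z y != 0)].
    by case/andP: zP => zA zy; exists z => //; exact: Qker_succs.
  case/eqP: h; apply: big1 => z _; have := none z; rewrite /= inE.
  by case: eqP => [->|_ /negbFE/eqP ->]; rewrite ?mul0r ?mulr0.
apply: leq_trans (subset_leq_card sub) _.
apply: leq_trans (_ : (\sum_(z in A) #|succs z| <= _)%N).
  by elim/big_ind2: _ => [|a b c d ab cd|//]; rewrite ?cards0 //;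
     apply: leq_trans (leq_card_setU _ _) (leq_add ab cd).
apply: leq_trans (_ : (\sum_(z in A) n * n <= _)%N); last first.
  by rewrite sum_nat_const expnSr leq_mul2r IH orbT.
apply: leq_sum => z _; apply: leq_trans (leq_imset_card _ _) _.
by rewrite card_prod !card_ord.
Qed.

(** Off the support of [Qpow t x] the deviation is the uniform mass itself. It is at most the full
    L1 distance, hence at most 1/2, so the support contains half of St(n,k). *)
Lemma tv_support (n k t : nat) (x : config n k) : (0 < n)%N ->
  x \in St n k -> tv_dist t x <= 4^-1 ->
  (#|St n k| <= 2 * (n * n) ^ t)%N.
Proof.
move=> n0 xS; rewrite tv_distE => tv.
pose A := [set y | Qpow t x y != 0].
have N0 : 0 < #|St n k|%:R :> R by rewrite ltr0n; apply/card_gt0P; exists x.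
have sumA : (\sum_(y in St n k | y \notin A) unif y : R) <= 2^-1.
  apply: (@le_trans _ _ (\sum_(y in St n k) `|Qpow t x y - unif y|)).
    rewrite [leRHS](bigID (fun y => y \notin A)) /= -[leLHS]addr0 lerD //.
      apply: ler_sum => y /andP[_]; rewrite inE negbK => /eqP ->.
      by rewrite sub0r normrN ler_norm.
    by apply: sumr_ge0 => y _.
  by move: tv; lra.
have cardD : (#|St n k| <= #|A| + #|[set y in St n k | y \notin A]|)%N.
  apply: leq_trans (leq_card_setU _ _).1; apply/subset_leq_card/subsetP => y yS.
  rewrite in_setU; have [//|yA] := boolP (y \in A).
  by rewrite /= in_set yS yA.
have {}sumA : #|[set y in St n k | y \notin A]|%:R <= #|St n k|%:R / 2 :> R.
  rewrite mulrC -ler_pdivrMr //; apply: le_trans sumA.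
  rewrite -sum1_card natr_sum mulr_suml le_eqVlt; apply/orP; left; apply/eqP.
  by apply: eq_big => [y|y _]; rewrite ?in_set // mul1r.
have : #|St n k|%:R <= 2 * #|A|%:R :> R.
  by move: cardD sumA; rewrite -(ler_nat R) natrD; lra.
rewrite -natrM ler_nat => h; apply: leq_trans h _.
by rewrite leq_mul2l /= Qpow_support.
Qed.

(** * Lower bound on the number of states *)

(** Forward substitution: the rows of a matrix killed by [M] vanish one after another from the
    top. *)
Lemma unitriangular_St (n k : nat) (M : config n k) : (k <= n)%N ->
  (forall (i : 'I_n) (j : 'I_k), (i <= j)%N -> M i j = (i == j :> nat)%:R) ->
  M \in St n k.
Proof.
move=> kn ME; rewrite inE; apply: row_full_ker => B MB.
suff H m : forall (i : 'I_k) c, (i < m)%N -> B i c = 0.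
  by apply/matrixP => i c; rewrite (H k) ?mxE.
elim: m => // m IH i c; rewrite ltnS leq_eqVlt => /orP[/eqP im|]; last exact: IH.
have := congr1 (fun A : 'M_(n, k) => A (widen_ord kn i) c) MB.
rewrite !mxE (bigD1 i) //= ME //= eqxx mul1r big1 ?addr0 // => j ji.
have [jm|mj] := ltnP j m; first by rewrite IH ?mulr0.
have ij : (i < j)%N by rewrite ltn_neqAle eq_sym ji im.
by rewrite ME //= ?(ltn_eqF ij) ?mul0r // ltnW.
Qed.

Lemma card_below_diag (n k : nat) : (k <= n)%N ->
  (k * n.-1 <= 2 * #|[set ij : 'I_n * 'I_k | (ij.2 < ij.1)%N]|)%N.
Proof.
move=> kn.
have -> : #|[set ij : 'I_n * 'I_k | (ij.2 < ij.1)%N]| = (\sum_(j < k) (n.-1 - j))%N.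
  rewrite -sum1_card (eq_bigl _ _ (in_set _)).
  rewrite -(pair_big_dep xpredT (fun (i : 'I_n) (j : 'I_k) => (j < i)%N) (fun _ _ => 1%N)) /=.
  rewrite (exchange_big_dep xpredT) //=; apply: eq_bigr => j _.
  rewrite -(big_mkord (fun i => (j < i)%N) (fun=> 1%N)) /=.
  have jn : (j < n)%N by apply: leq_trans kn.
  rewrite -(@big_nat_widenl _ _ _ j.+1 0 n xpredT) // sum_nat_const_nat muln1.
  by case: (n) jn => // m; rewrite subSS.
(* Since [k <= n], the last factor is at least [n - 1]. *)
suff -> : (2 * \sum_(j < k) (n.-1 - j) = k * (2 * n - 1 - k))%N by nia.
elim: k kn => [|k IH] kn; first by rewrite big_ord0.
by rewrite big_ord_recr /= mulnDr IH 1?ltnW //; nia.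
Qed.

(** The entries strictly below a unit diagonal can be chosen freely. Squaring avoids the halved
    exponent. *)
Lemma card_St (n k : nat) : (k <= n)%N -> (2 ^ (k * n.-1) <= #|St n k| ^ 2)%N.
Proof.
move=> kn; pose D := [set ij : 'I_n * 'I_k | (ij.2 < ij.1)%N].
pose f (A : {set 'I_n * 'I_k}) : config n k :=
  \matrix_(i, j) ((i == j :> nat)%:R + ((i, j) \in A)%:R).
have finj : injective f.
  move=> A B /matrixP e; apply/setP => [[i j]]; have := e i j; rewrite !mxE.
  by move=> /addrI; do 2 case: (_ \in _).
have sub : f @: powerset D \subset St n k.
  apply/subsetP => M /imsetP[A]; rewrite inE => /subsetP AD ->.
  apply: unitriangular_St => // i j ij; rewrite mxE.
  case: ((i, j) \in A) (AD (i, j)) => [/(_ isT)|_]; last by rewrite addr0.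
  by rewrite inE /= ltnNge ij.
have := subset_leq_card sub; rewrite card_imset // card_powerset => le.
apply: leq_trans (_ : (2 ^ #|D|) ^ 2 <= _)%N; last by rewrite leq_exp2r.
by rewrite -expnM leq_exp2l // [leqRHS]mulnC; exact: card_below_diag.
Qed.

(** * Column weight: growth along the walk and mean at stationarity *)

Definition colwt (n k : nat) (j : 'I_k) (x : config n k) : nat :=
  \sum_(i < n) (x i j != 0%R).

Lemma colwt_transv (n k : nat) (j : 'I_k) (x : config n k) (a b : 'I_n) :
  (colwt j (transv x a b) <= colwt j x + (x a j != 0%R))%N.
Proof.
rewrite /colwt (bigD1 b) //= [in leqRHS](bigD1 b) //= !mxE eqxx.
rewrite [X in (_ + X <= _)%N](eq_bigr (fun i => nat_of_bool (x i j != 0%R))); last first.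
  by move=> i /negbTE ib; rewrite !mxE ib.
rewrite addnAC leq_add2r.
have [->|_] := eqVneq (x a j) 0; first by rewrite addr0 addn0.
exact: leq_trans (leq_b1 _) (leq_addl _ _).
Qed.

(** Only a source row that is nonzero in column [j] can raise the weight, by at most 1. Such a row
    is drawn with probability [colwt j x / n], and laziness halves the gain. *)
Lemma Qker_colwt (n k : nat) (j : 'I_k) (x : config n k) :
  (1 < n)%N -> x \in St n k ->
  \sum_(y in St n k) Qker x y * (colwt j y)%:R <=
  (1 + (2 * n%:R)^-1) * (colwt j x)%:R :> R.
Proof.
move=> n1 xS; rewrite (Qker_expect (fun y => (colwt j y)%:R)) //.
have n0 : 0 < n%:R :> R by rewrite ltr0n; case: n n1 {x xS}.
have m0 : 0 < n.-1%:R :> R by rewrite ltr0n; case: n n1 {x xS n0} => [|[]].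
set S := \sum_(ab | _) _; set f := (colwt j x)%:R.
have SE : S <= (n * n.-1)%N%:R * f + n.-1%:R * f.
  apply: (@le_trans _ _ (\sum_(ab : 'I_n * 'I_n | ab.1 != ab.2)
            (f + (x ab.1 j != 0)%:R))).
    by apply: ler_sum => ab _; rewrite -natrD ler_nat colwt_transv.
  rewrite big_split /= sumr_const pairs_card mulr_natl lerD2l.
  rewrite -(pair_big_dep xpredT (fun a b : 'I_n => a != b)
              (fun a _ => (x a j != 0)%:R)) /=.
  rewrite /f /colwt natr_sum mulr_sumr; apply: ler_sum => a _.
  rewrite sumr_const mulr_natl ler_wpMn2l ?ler0n //.
  rewrite -[X in (_ <= X.-1)%N](card_ord n) -(cardC1 a).
  by apply/eq_leq/eq_card => b; rewrite !inE eq_sym.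
have -> : (1 + (2 * n%:R)^-1) * f =
    (f + ((n * n.-1)%N%:R * f + n.-1%:R * f) / (n * n.-1)%N%:R) / 2.
  by rewrite natrM; field; rewrite ?gt_eqF.
rewrite ler_pM2r ?invr_gt0 ?ltr0n // lerD2l ler_pM2r // invr_gt0.
by rewrite natrM mulr_gt0.
Qed.

Lemma Qpow_colwt (n k t : nat) (j : 'I_k) (x : config n k) :
  (1 < n)%N -> x \in St n k ->
  \sum_(y in St n k) Qpow t x y * (colwt j y)%:R <=
  (1 + (2 * n%:R)^-1) ^+ t * (colwt j x)%:R :> R.
Proof.
move=> n1 xS; elim: t => [|t IH].
  by rewrite expr0 mul1r (delta_expect (fun y => (colwt j y)%:R)).
rewrite Qpow_expectS exprS -mulrA.
apply: (@le_trans _ _ (\sum_(z in St n k)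
     Qpow t x z * ((1 + (2 * n%:R)^-1) * (colwt j z)%:R))).
  by apply: ler_sum => z zS; rewrite ler_wpM2l ?Qpow_ge0 ?Qker_colwt.
under eq_bigr do rewrite mulrCA.
rewrite -big_distrr /= ler_wpM2l // addr_ge0 ?ler01 // invr_ge0.
by rewrite mulr_ge0 ?ler0n.
Qed.

Lemma col_nonzero (n k : nat) (j : 'I_k) (x : config n k) : x \in St n k ->
  exists a, x a j != 0.
Proof.
rewrite inE => /row_full_inj inj.
have [a aP|none] := pickP [pred a | x a j != 0]; first by exists a.
have xj : x *m delta_mx j 0 = 0 :> 'cV_n.
  rewrite -colE; apply/matrixP => i c; rewrite !mxE.
  by have := none i => /= /negbFE/eqP.
have := inj 1%N _ 0 (etrans xj (esym (mulmx0 _ _))).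
by move/matrixP/(_ j 0); rewrite !mxE !eqxx.
Qed.

(* Adding to row i the first other row that is nonzero in column j injects
   {x i j = 0} into {x i j = 1}, since column j off row i is unchanged. *)
Lemma card_entry (n k : nat) (i : 'I_n) (j : 'I_k) :
  (#|St n k| <= 2 * #|[set x in St n k | x i j != 0%R]|)%N.
Proof.
pose Z := [set x in St n k | x i j == 0%R].
pose W := [set x in St n k | x i j != 0%R].
pose p (x : config n k) := [pick a | (a != i) && (x a j != 0%R)].
pose f (x : config n k) := if p x is Some a then transv x a i else x.
have fW x : x \in Z -> [/\ f x \in W, p (f x) = p x &
      exists2 a, p x = Some a & f x = transv x a i /\ a != i].
  rewrite inE => /andP[xS /eqP x0].
  have [a xa] := col_nonzero j xS.
  have pE b : p (transv x b i) = p x.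
    by apply: eq_pick => c; rewrite /= !mxE; case: eqP.
  have [b pb [bi xb]] : exists2 b, p x = Some b & b != i /\ x b j != 0.
    rewrite /p; case: pickP => [b /andP[bi xb]|/(_ a)]; first by exists b.
    by rewrite /= xa andbT => /negbFE/eqP ai; rewrite ai x0 eqxx in xa.
  rewrite /f pb pE; split=> //; last by exists b.
  by rewrite inE transv_St // xS !mxE eqxx x0 add0r.
have ZW : (#|Z| <= #|W|)%N.
  rewrite -(card_in_imset (f := f)).
    apply/subset_leq_card/subsetP => _ /imsetP[x xZ ->].
    by have [] := fW x xZ.
  move=> x y xZ yZ e.
  have [_ px [a pa [fx ai]]] := fW x xZ; have [_ py [b pb [fy bi]]] := fW y yZ.
  have ab : a = b by move: px py; rewrite e => -> ; rewrite pa pb => -[].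
  by rewrite -(transvK x ai) -fx e fy ab transvK.
have -> : #|St n k| = (#|W| + #|Z|)%N.
  rewrite -cardsUI (_ : W :&: Z = set0); last first.
    by apply/setP => x; rewrite !inE; case: (x i j == 0); rewrite ?andbF.
  rewrite cards0 addn0; apply: eq_card => x; rewrite in_setU !in_set.
  by case: (x i j == 0); rewrite ?andbF ?andbT ?orbF.
by rewrite mul2n -addnn leq_add2l.
Qed.

Lemma unif_colwt (n k : nat) (j : 'I_k) :
  n%:R / 2 * #|St n k|%:R <= \sum_(y in St n k) (colwt j y)%:R :> R.
Proof.
have H : (n * #|St n k| <= 2 * \sum_(y in St n k) colwt j y)%N.
  rewrite /colwt exchange_big /= big_distrr /= -{1}(card_ord n) -sum_nat_const.
  apply: leq_sum => i _; apply: leq_trans (card_entry i j) _.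
  rewrite leq_mul2l /= -sum1_card big_mkcond [leqRHS]big_mkcond.
  by apply: leq_sum => x _; rewrite inE; case: (x \in _); case: (_ == _).
by rewrite -natr_sum; move: H; rewrite -(ler_nat R) !natrM; lra.
Qed.

Lemma mixed_growth (n k t : nat) : (1 < n)%N -> (0 < k <= n)%N ->
  mixed n k t -> n%:R / 4 <= (1 + (2 * n%:R)^-1) ^+ t :> R.
Proof.
move=> n1 /andP[k0 kn] /forall_inP mx.
pose j := Ordinal k0.
pose x : config n k := \matrix_(i, c) (i == c :> nat)%:R.
have xS : x \in St n k by apply: unitriangular_St => // i c _; rewrite mxE.
have wx : colwt j x = 1%N.
  rewrite /colwt (bigD1 (widen_ord kn j)) //= mxE eqxx big1 // => i ij.
  rewrite mxE (_ : (i == j :> nat) = false); first by rewrite eqxx.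
  by apply: contraNF ij => /eqP e; apply/eqP/val_inj.
have := mx x xS; rewrite tv_distE; set D := \sum_(y in _) _ => tv.
have up := Qpow_colwt t j n1 xS; rewrite wx mulr1 in up.
apply: le_trans up.
have N0 : 0 < #|St n k|%:R :> R by rewrite ltr0n; apply/card_gt0P; exists x.
have low : n%:R / 2 <= \sum_(y in St n k) unif y * (colwt j y)%:R :> R.
  by rewrite /unif -big_distrr /= [leRHS]mulrC ler_pdivlMr // unif_colwt.
(* centering colwt at n / 2 halves its sup norm *)
have dev : `|\sum_(y in St n k) (Qpow t x y - unif y) * ((colwt j y)%:R - n%:R / 2)|
     <= D * (n%:R / 2).
  apply: le_trans (ler_norm_sum _ _ _) _; rewrite mulr_suml.
  apply: ler_sum => y _; rewrite normrM ler_wpM2l //.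
  have : (colwt j y <= n)%N.
    rewrite -[leqRHS](card_ord n) -sum1_card; apply: leq_sum => i _.
    by case: (_ != _).
  rewrite -(ler_nat R) => h; have := ler0n R (colwt j y).
  by rewrite ler_norml; lra.
have E : \sum_(y in St n k) (Qpow t x y - unif y) * ((colwt j y)%:R - n%:R / 2) =
    \sum_(y in St n k) Qpow t x y * (colwt j y)%:R
    - \sum_(y in St n k) unif y * (colwt j y)%:R.
  under eq_bigr do rewrite mulrBr.
  rewrite sumrB -mulr_suml [X in X * _]sumrB Qpow_sum1 // (sum_unif xS).
  rewrite subrr mul0r subr0 -sumrB.
  by apply: eq_bigr => y _; rewrite mulrBl.
have Dn : D * (n%:R / 2) <= n%:R / 4.
  have : 0 <= (2^-1 - D) * n%:R by rewrite mulr_ge0 ?ler0n //; lra.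
  by lra.
by move: dev; rewrite E ler_norml => /andP[dev _]; lra.
Qed.

Lemma ler_ln (x y : R) : 0 < x -> x <= y -> ln x <= ln y.
Proof.
move=> /RltP x0; rewrite le_eqVlt => /predU1P[->//|/RltP xy].
exact/ltW/RltP/ln_increasing.
Qed.

Lemma lnX (x : R) (m : nat) : 0 < x -> ln (x ^+ m) = m%:R * ln x.
Proof. by move=> /RltP x0; rewrite -RpowE ln_pow // INRE. Qed.

Lemma mixed_ge_nlogn (n k t : nat) : (16 <= n)%N -> (0 < k <= n)%N ->
  mixed n k t -> n%:R * ln n%:R <= t%:R.
Proof.
move=> n16 kn mx; have n1 : (1 < n)%N by apply: leq_trans n16.
have n0 : 0 < n%:R :> R by rewrite ltr0n; apply: leq_trans n16.
have n16R : 16 <= n%:R :> R by rewrite (ler_nat R 16).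
have g := mixed_growth n1 kn mx.
have e1 : 1 + (2 * n%:R)^-1 <= exp (2 * n%:R)^-1.
  exact/RleP/exp_ineq1_le.
have h0 : 0 <= (2 * n%:R)^-1 :> R by rewrite invr_ge0 mulr_ge0 ?ler0n.
have {}g : n%:R / 4 <= exp ((2 * n%:R)^-1 *+ t).
  by rewrite -expRX (le_trans g) // lerXn2r ?nnegrE // ?addr_ge0 // (le_trans _ e1) ?addr_ge0.
have sq : n%:R <= (n%:R / 4) ^+ 2 :> R.
  rewrite expr2 -subr_ge0.
  have : 0 <= n%:R * (n%:R - 16) :> R by rewrite mulr_ge0 ?ler0n ?subr_ge0.
  by lra.
have {}g : n%:R <= exp ((2 * n%:R)^-1 *+ t *+ 2).
  rewrite -expRX (le_trans sq) // lerXn2r ?nnegrE ?divr_ge0 ?ler0n //.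
  by apply: le_trans g; rewrite divr_ge0 ?ler0n.
have := ler_ln n0 g; rewrite ln_exp.
have -> : (2 * n%:R)^-1 *+ t *+ 2 = t%:R / n%:R :> R.
  by rewrite -[LHS]mulr_natr -[_ *+ t]mulr_natr; field; rewrite gt_eqF.
by rewrite ler_pdivlMr // mulrC.
Qed.

Lemma mixed_ge_counting (n k t : nat) : (6 <= n)%N -> (0 < k <= n)%N ->
  mixed n k t -> (n * k)%N%:R <= 16 * t%:R * ln n%:R :> R.
Proof.
move=> n6 /andP[k0 kn] /forall_inP mx.
have n0 : (0 < n)%N by apply: leq_trans n6.
have [St0|[x xS]] := set_0Vmem (St n k).
  by have := card_St kn; rewrite St0 cards0 leqNgt expn_gt0.
have le : (2 ^ (k * n.-1) <= 2 ^ 2 * n ^ (4 * t))%N.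
  apply: leq_trans (card_St kn) _.
  apply: leq_trans (_ : (2 * (n * n) ^ t) ^ 2 <= _)%N.
    by rewrite leq_exp2r // (tv_support n0 xS) // mx.
  by rewrite (mulnn n) expnMn -!expnM (_ : (2 * (t * 2) = 4 * t)%N) //; lia.
have {}le : 2 ^+ (k * n.-1) <= 2 ^+ 2 * n%:R ^+ (4 * t) :> R.
  by rewrite -!natrX -natrM ler_nat.
have n0R : 0 < n%:R :> R by rewrite ltr0n.
have {}le : (k * n.-1)%:R * ln 2%:R <= 2 * ln 2%:R + (4 * t)%N%:R * ln n%:R :> R.
  rewrite -!lnX ?ltr0n // -RplusE -ln_mult; try by apply/RltP; rewrite exprn_gt0 ?ltr0n.
  by rewrite ler_ln ?exprn_gt0 ?ltr0n.
have ln2 : 2^-1 <= ln 2%:R :> R by have /RltP/ltW := ln_lt_2; rewrite IZR2E.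
have nk : (n * k)%N%:R + 4 <= 2 * (k * n.-1)%N%:R :> R.
  by rewrite -natrM -natrD ler_nat; nia.
have : 0 <= ((k * n.-1)%N%:R - 2) * (ln 2%:R - 2^-1) :> R.
  by rewrite mulr_ge0 ?subr_ge0 // (ler_nat R 2); nia.
by move: le; rewrite natrM [(4 * t)%N%:R]natrM; nra.
Qed.

Lemma tau_mix_mixed (n k : nat) : (1 < n)%N -> (k <= n)%N ->
  mixed n k (tau_mix n k).
Proof.
move=> n1 kn; rewrite /tau_mix; case: excluded_middle_informative => [h|].
  by case: ex_minnP.
by case; exact: exists_mixed.
Qed.

Theorem theorem1p2 :
  exists c : R, 0 < c /\
  exists N : nat, forall n k : nat, (N <= n)%N -> (1 <= k <= n)%N ->
    c * Num.max (n%:R * ln n%:R) ((n * k)%N%:R / ln (exp 1 * n%:R))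
      <= (tau_mix n k)%:R.
Proof.
exists 16^-1; split; first by rewrite invr_gt0 ltr0n.
exists 16%N => n k n16 kn.
have n1 : (1 < n)%N by apply: leq_trans n16.
have mx : mixed n k (tau_mix n k) by apply: tau_mix_mixed => //; case/andP: kn.
have n0 : 0 < n%:R :> R by rewrite ltr0n ltnW.
have ln0 : 0 <= ln n%:R.
  have : 1 <= n%:R :> R by rewrite (ler_nat R 1) ltnW.
  by move/(ler_ln ltr01); rewrite ln_1.
have lnE : ln (exp 1 * n%:R) = 1 + ln n%:R.
  by rewrite ln_mult ?ln_exp //; [exact: exp_pos | exact/RltP].
rewrite mulrC ler_pdivrMr ?ltr0n // ge_max; apply/andP; split.
  apply: le_trans (mixed_ge_nlogn n16 kn mx) _.
  by rewrite ler_peMr ?ler0n // (ler_nat R 1).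
have := mixed_ge_counting (leq_trans _ n16) kn mx.
rewrite lnE ler_pdivrMr; last by rewrite ltr_wpDr // ltr01.
move=> /(_ isT) h; apply: le_trans h _.
rewrite [16 * _]mulrC ler_wpM2l ?mulr_ge0 ?ler0n //.
by rewrite lerDr ler01.
Qed.
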